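(* Let $n,p\in\mathbb{N}$ and let $m$ be an even positive integer. Let $\mathcal{F}_l$, $l=0,1,\ldots,p$, be $m$th-order $n$-dimensional real symmetric tensors. Suppose that there exists a nonsingular real $n\times n$ matrix $P$ such that $P^m\mathcal{F}_l$, $l=0,1,\ldots,p$, are all essentially nonpositive tensors. Then one and exactly one of the following statements holds: (i) there exists $x\in\mathbb{R}^n$ such that $\langle \mathcal{F}_l, x^{\otimes m}\rangle<0$ for all $l=0,1,\ldots,p$; (ii) there exist $\lambda_l\ge 0$, $l=0,1,\ldots,p$, with $\sum_{l=0}^p\lambda_l=1$, such that $\sum_{l=0}^p\lambda_l\mathcal{F}_l\in \mathrm{SOS}_{m,n}$.
   Context: $\mathbb{N}=\{1,2,\ldots\}$. An $m$th-order $n$-dimensional tensor is an array $\mathcal{A}=(\mathcal{A}_{i_1\cdots i_m})_{1\le i_1,\ldots,i_m\le n}$ of real numbers; it is symmetric if its entries are invariant under every permutation of the indices. $\langle \mathcal{A},\mathcal{B}\rangle=\sum_{i_1,\ldots,i_m=1}^n \mathcal{A}_{i_1\cdots i_m}\mathcal{B}_{i_1\cdots i_m}$. For $x\in\mathbb{R}^n$, $x^{\otimes m}$ is the tensor with entries $(x^{\otimes m})_{i_1\cdots i_m}=x_{i_1}\cdots x_{i_m}$. A tensor $\mathcal{A}$ is essentially nonpositive if $\mathcal{A}_{i_1\cdots i_m}\le 0$ for every $(i_1,\ldots,i_m)\notin\{(i,i,\ldots,i):1\le i\le n\}$. For a real $n\times n$ matrix $P=(P_{ij})$, $P^m\mathcal{A}$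 denotes the $m$th-order $n$-dimensional tensor with entries $(P^m\mathcal{A})_{i_1\cdots i_m}=\sum_{j_1,\ldots,j_m=1}^n P_{i_1j_1}\cdots P_{i_mj_m}\mathcal{A}_{j_1\cdots j_m}$. $\mathrm{SOS}_{m,n}$ is the set of all $m$th-order $n$-dimensional symmetric tensors $\mathcal{A}$ such that the polynomial $x\mapsto\langle\mathcal{A},x^{\otimes m}\rangle$ on $\mathbb{R}^n$ is a sum of squares of finitely many real polynomials. *)

(* Defs.v *)
From mathcomp Require Import all_boot all_order all_fingroup all_algebra.
From mathcomp Require Import reals.
From mathcomp Require Import mpoly.

Set Implicit Arguments.
Unset Strict Implicit.
Unset Printing Implicit Defensive.

Import Order.TTheory GRing.Theory Num.Theory.
Local Open Scope ring_scope.

(* Entries are taken in R^o rather than R so that the library's pointwise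
   module structure provides linear combinations of tensors. *)
Notation tensor R m n := {ffun {ffun 'I_m -> 'I_n} -> R^o}.

Section Tensors.
Context {R : realType} {m n : nat}.
Implicit Types (A B : tensor R m n) (x : 'rV[R]_n).

Definition symmetric_tensor A : Prop :=
  forall (s : 'S_m) (i : {ffun 'I_m -> 'I_n}), A [ffun k => i (s k)] = A i.

Definition tensor_inner A B : R :=
  \sum_(i : {ffun 'I_m -> 'I_n}) A i * B i.

Definition tensor_power x : tensor R m n :=
  [ffun i : {ffun 'I_m -> 'I_n} => \prod_(k < m) x ord0 (i k)].

Definition essentially_nonpositive A : Prop :=
  forall i : {ffun 'I_m -> 'I_n},
    ~ (exists j : 'I_n, i = [ffun=> j]) -> A i <= 0.

Definition tensor_transform (P : 'M[R]_n) A : tensor R m n :=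
  [ffun i : {ffun 'I_m -> 'I_n} =>
     \sum_(j : {ffun 'I_m -> 'I_n}) (\prod_(k < m) P (i k) (j k)) * A j].

Definition SOS_tensor A : Prop :=
  symmetric_tensor A /\
  exists qs : seq {mpoly R[n]}, forall x : 'rV[R]_n,
    tensor_inner A (tensor_power x) = \sum_(q <- qs) q.@[x ord0] ^+ 2.

End Tensors.

(* Main.v *)
(** After the change of variables by [P], the forms become
    [f_l u = \sum_i d_l,i u_i ^+ m - \sum_j a_l,j u^j] with [a_l,j >= 0], [j] ranging
    over index tuples. If (i) fails, some [f_l u] is nonnegative at every positive [u],
    so for [e > 0] the function
    [\sum_l expR (f_l u + e * \sum_i u_i ^+ m) / \prod_i u_i] attains its minimum on
    the open orthant. Its critical point equations, with [lam] the normalized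
    exponentials, bound the diagonal coefficients of [\sum_l lam_l f_l] from below by
    the weights of tight AM-GM inequalities, one for each off-diagonal monomial; the
    weights are the [r j k ^+ m] below. By compactness such weights survive [e -> 0].
    Finally, for even [m], each difference [\sum_k w_k ^+ m - m \prod_k w_k] is a sum
    of squares (Hurwitz), hence so is [\sum_l lam_l f_l]. *)

Require Import Defs.
From mathcomp Require Import all_boot all_order all_fingroup all_algebra.
From mathcomp Require Import reals.
From mathcomp Require Import mpoly.
From mathcomp Require Import ring lra.
From mathcomp Require boolp classical_sets topology normedtype derive realfun exp sequences.

Set Implicit Arguments.
Unset Strict Implicit.
Unset Printing Implicit Defensive.

Import Order.TTheory GRing.Theory Num.Theory.
Local Open Scope ring_scope.

(** * Sums of squares and the AM-GM difference *)

Section SumsOfSquares.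
Context {R : rcfType} {A : comAlgType R}.
Implicit Types (a b : A).

Definition is_sos a := exists qs : seq A, a = \sum_(q <- qs) q ^+ 2.

Lemma is_sos0 : is_sos 0.
Proof. by exists [::]; rewrite big_nil. Qed.

Lemma is_sos_sqr a : is_sos (a ^+ 2).
Proof. by exists [:: a]; rewrite big_seq1. Qed.

Lemma is_sosD a b : is_sos a -> is_sos b -> is_sos (a + b).
Proof. by move=> [s ->] [t ->]; exists (s ++ t); rewrite big_cat. Qed.

Lemma is_sos_sum (I : Type) (r : seq I) (P : pred I) (f : I -> A) :
  (forall i, P i -> is_sos (f i)) -> is_sos (\sum_(i <- r | P i) f i).
Proof. by move=> fP; apply: big_ind => //; [exact: is_sos0|exact: is_sosD]. Qed.

Lemma is_sosM a b : is_sos a -> is_sos b -> is_sos (a * b).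
Proof.
move=> [s ->] [t ->]; rewrite big_distrl; apply: is_sos_sum => x _ /=.
rewrite big_distrr; apply: is_sos_sum => y _ /=.
by rewrite -exprMn; apply: is_sos_sqr.
Qed.

Lemma is_sosX a k : is_sos a -> is_sos (a ^+ k).
Proof.
move=> sa; elim: k => [|k IHk].
  by rewrite expr0 -(expr1n _ 2); apply: is_sos_sqr.
by rewrite exprS; apply: is_sosM.
Qed.

Lemma is_sos_expr_even a k : ~~ odd k -> is_sos (a ^+ k).
Proof.
by move=> ek; rewrite -(even_halfK ek) -muln2 exprM; apply: is_sos_sqr.
Qed.

Lemma is_sosZ (c : R) a : 0 <= c -> is_sos a -> is_sos (c *: a).
Proof.
move=> c0 [s ->]; rewrite scaler_sumr; apply: is_sos_sum => x _.
by rewrite -[c]sqr_sqrtr// -exprZn; apply: is_sos_sqr.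
Qed.

Lemma is_sos_nat k a : is_sos a -> is_sos (k%:R * a).
Proof.
by move=> sa; rewrite mulr_natl -scaler_nat; apply: is_sosZ (ler0n _ _) sa.
Qed.

Lemma is_sos_natK k a : (0 < k)%N -> is_sos (k%:R * a) -> is_sos a.
Proof.
move=> k0 sa; have k0' : k%:R != 0 :> R by rewrite pnatr_eq0 -lt0n.
have -> : a = k%:R^-1 *: (k%:R * a).
  by rewrite mulr_natl -scaler_nat scalerA mulVf// scale1r.
by apply: is_sosZ sa; rewrite invr_ge0 ler0n.
Qed.

(** The factor [a - b] of [a ^+ k - b ^+ k] pairs with the other one into a square; the cofactor is
    a sum of products of powers of [a] and [b]. *)
Lemma is_sos_subX_sub a b k : is_sos a -> is_sos b ->
  is_sos ((a ^+ k - b ^+ k) * (a - b)).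
Proof.
move=> sa sb; rewrite subrXX mulrAC; apply: is_sosM.
  by rewrite -expr2; apply: is_sos_sqr.
by apply: is_sos_sum => i _; apply: is_sosM; apply: is_sosX.
Qed.

(* Hurwitz's induction: with [S j = \sum_i y i ^+ j] over the [k.+1] indices,
   [2 k (S k.+1 - k.+1 \prod y)] is
   [2 \sum_j y j (AM-GM for the k variables other than y j)] plus
   [\sum_(i, j) (y i ^+ k - y j ^+ k) (y i - y j)]. *)
Lemma amgm_is_sos k (y : 'I_k -> A) : (forall i, is_sos (y i)) ->
  is_sos (\sum_i y i ^+ k - k%:R * \prod_i y i).
Proof.
elim: k y => [|[|k] IHk] y sy.
- by rewrite big_ord0 mul0r subr0; apply: is_sos0.
- rewrite big_ord_recl big_ord0 big_ord_recl big_ord0 /= addr0 mulr1 mul1r expr1.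
  by rewrite subrr; apply: is_sos0.
set K := k.+1 in IHk *.
apply: (@is_sos_natK (2 * K)); first by rewrite muln_gt0.
have -> : (2 * K)%:R * (\sum_i y i ^+ K.+1 - K.+1%:R * \prod_i y i) =
  2%:R * (\sum_j y j * (\sum_i y (lift j i) ^+ K
             - K%:R * \prod_i y (lift j i))) +
  \sum_i \sum_j (y i ^+ K - y j ^+ K) * (y i - y j).
  have -> : \sum_j y j * (\sum_i y (lift j i) ^+ K
             - K%:R * \prod_i y (lift j i)) =
     (\sum_j y j) * (\sum_i y i ^+ K) - \sum_i y i ^+ K.+1
       - (K.+1 * K)%:R * \prod_i y i.
    have E j : y j * (\sum_i y (lift j i) ^+ K - K%:R * \prod_i y (lift j i))
        = y j * (\sum_i y i ^+ K) - y j ^+ K.+1 - K%:R * \prod_i y i.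
      rewrite [\sum_i y i ^+ K](@bigD1_ord _ _ _ _ j xpredT)//=.
      by rewrite [\prod_i y i](@bigD1_ord _ _ _ _ j xpredT)//= exprS; ring.
    rewrite (eq_bigr _ (fun j _ => E j)).
    rewrite !sumrB -mulr_suml sumr_const card_ord natrM -[_ *+ k.+2]mulr_natl.
    by rewrite -/K; ring.
  have -> : \sum_i \sum_j (y i ^+ K - y j ^+ K) * (y i - y j) =
     (2 * K.+1)%:R * (\sum_i y i ^+ K.+1)
       - 2%:R * ((\sum_j y j) * (\sum_i y i ^+ K)).
    have E i j : (y i ^+ K - y j ^+ K) * (y i - y j) =
        (y i ^+ K.+1 + y j ^+ K.+1) - (y i ^+ K * y j + y i * y j ^+ K).
      by rewrite !exprS; ring.
    under eq_bigr => i _ do rewrite (eq_bigr _ (fun j _ => E i j)) sumrB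
      !big_split sumr_const card_ord -[_ *+ k.+2]mulr_natl -!mulr_sumr/=.
    rewrite sumrB !big_split sumr_const card_ord -[_ *+ k.+2]mulr_natl.
    by rewrite -mulr_sumr -!mulr_suml/= -/K; ring.
  by rewrite !natrM -[K.+1%:R]natr1; ring.
apply: is_sosD; last first.
  by apply: is_sos_sum => i _; apply: is_sos_sum => j _; apply: is_sos_subX_sub.
apply: is_sos_nat; apply: is_sos_sum => j _.
by apply: is_sosM => //; apply: IHk => i.
Qed.

(** Here the [w i] are arbitrary. Split the [k = 2q] variables into halves with products [u] and
    [v]: AM-GM for the squares in each half leaves [q u^2] and [q v^2], and [q (u - v)^2] supplies
    the cross term. *)
Lemma amgm_even_is_sos k (w : 'I_k -> A) : ~~ odd k ->
  is_sos (\sum_i w i ^+ k - k%:R * \prod_i w i).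
Proof.
move=> ek; have ek2 := even_halfK ek; rewrite -addnn in ek2.
move: ek2 w; move: (k./2) => q <- {k ek} w.
pose u := \prod_i w (lshift q i); pose v := \prod_i w (rshift q i).
have half (z : 'I_q -> A) :
    is_sos (\sum_i z i ^+ (q + q) - q%:R * (\prod_i z i) ^+ 2).
  have E i : z i ^+ (q + q) = (z i ^+ 2) ^+ q by rewrite -exprM mul2n addnn.
  rewrite -prodrXl (eq_bigr _ (fun i _ => E i)).
  by apply: amgm_is_sos => i; apply: is_sos_sqr.
have -> : \sum_i w i ^+ (q + q) - (q + q)%:R * \prod_i w i =
   (\sum_i w (lshift q i) ^+ (q + q) - q%:R * u ^+ 2) +
   (\sum_i w (rshift q i) ^+ (q + q) - q%:R * v ^+ 2) + q%:R * (u - v) ^+ 2.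
  by rewrite !big_split_ord /= natrD /u /v; ring.
apply: is_sosD; first by apply: is_sosD; apply: half.
by apply: is_sos_nat; apply: is_sos_sqr.
Qed.

(** By the condition on [\prod_k r j k], each tail term is [m] times the product of the
    [r j k *: y (t j k)], so an AM-GM difference absorbs it at the cost of [r j k ^+ m] from the
    coefficient of [y (t j k) ^+ m]. What remains of [d i] is nonnegative. *)
Lemma diagonal_minus_tail_is_sos (m n : nat) (T : finType) (t : T -> 'I_m -> 'I_n)
    (d : 'I_n -> R) (a : T -> R) (r : T -> 'I_m -> R) (y : 'I_n -> A) :
    (0 < m)%N -> ~~ odd m ->
    (forall j, \prod_k r j k = a j / m%:R) ->
    (forall i, \sum_j \sum_(k | t j k == i) r j k ^+ m <= d i) ->
  is_sos (\sum_i d i *: y i ^+ m - \sum_j a j *: \prod_k y (t j k)).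
Proof.
move=> m0 em ra rd.
have -> : \sum_i d i *: y i ^+ m - \sum_j a j *: \prod_k y (t j k) =
   \sum_i (d i - \sum_j \sum_(k | t j k == i) r j k ^+ m) *: y i ^+ m +
   \sum_j (\sum_k (r j k *: y (t j k)) ^+ m
             - m%:R * \prod_k (r j k *: y (t j k))).
  under [X in _ = X + _]eq_bigr => i _ do rewrite scalerBl.
  rewrite sumrB -[LHS]addr0 -!addrA; congr (_ + _).
  rewrite sumrB addr0 [X in _ = - X + _](_ : _ =
      \sum_j \sum_k (r j k *: y (t j k)) ^+ m).
    rewrite addKr; congr (- _); apply: eq_bigr => j _.
    rewrite scaler_prod ra mulr_natl -scaler_nat scalerA mulrCA divff ?mulr1//.
    by rewrite pnatr_eq0 -lt0n.
  under eq_bigr => i _ do rewrite scaler_suml.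
  rewrite exchange_big; apply: eq_bigr => j _ /=.
  rewrite [RHS](partition_big (t j) xpredT)//=; apply: eq_bigr => i _.
  by rewrite scaler_suml; apply: eq_bigr => k /eqP <-; rewrite exprZn.
apply: is_sosD; last by apply: is_sos_sum => j _; apply: amgm_even_is_sos.
apply: is_sos_sum => i _; apply: is_sosZ; first by rewrite subr_ge0.
exact: is_sos_expr_even.
Qed.

End SumsOfSquares.

Module CriticalPoint.
Import boolp classical_sets topology normedtype derive realfun exp sequences.
Import numFieldNormedType.Exports.

(** * Continuity of real-valued functions *)

Section Continuity.
Context {R : realType} {T : topologicalType}.
Implicit Types f g : T -> R.

Lemma continuous_addf f g : continuous f -> continuous g ->
  continuous (fun x => f x + g x).
Proof. by move=> cf cg x; exact: (continuousD (cf x) (cg x)). Qed.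

Lemma continuous_subf f g : continuous f -> continuous g ->
  continuous (fun x => f x - g x).
Proof. by move=> cf cg x; exact: (continuousB (cf x) (cg x)). Qed.

Lemma continuous_mulf f g : continuous f -> continuous g ->
  continuous (fun x => f x * g x).
Proof. by move=> cf cg x; exact: (continuousM (cf x) (cg x)). Qed.

Lemma continuous_scalef (c : R) f : continuous f -> continuous (fun x => c * f x).
Proof. by move=> cf; apply: continuous_mulf cf => x; apply: cvg_cst. Qed.

Lemma continuous_normf f : continuous f -> continuous (fun x => `|f x|).
Proof. by move=> cf x; exact: (cvg_norm (cf x)). Qed.

Lemma continuous_expf f k : continuous f -> continuous (fun x => f x ^+ k).
Proof. by move=> cf x; exact: (continuous_comp (cf x) (@exprn_continuous _ _ _)). Qed.

Lemma continuous_expRf f : continuous f -> continuous (fun x => expR (f x)).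
Proof. by move=> cf x; exact: (continuous_comp (cf x) (@continuous_expR _ _)). Qed.

Lemma continuous_cstf c : continuous (fun _ : T => c : R).
Proof. by move=> x; apply: cvg_cst. Qed.

Lemma continuous_sum (I : Type) (r : seq I) (P : pred I) (f : I -> T -> R) :
  (forall i, continuous (f i)) ->
  continuous (fun x => \sum_(i <- r | P i) f i x).
Proof.
by move=> cf; apply: continuous_big => [|i _]; [exact: add_continuous|exact: cf].
Qed.

Lemma continuous_prod (I : Type) (r : seq I) (P : pred I) (f : I -> T -> R) :
  (forall i, continuous (f i)) ->
  continuous (fun x => \prod_(i <- r | P i) f i x).
Proof.
by move=> cf; apply: continuous_big => [|i _]; [exact: mul_continuous|exact: cf].
Qed.

End Continuity.

(** * Minima on boxes and of coercive functions *)

Section Box.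
Context {R : realType} {n : nat}.
Implicit Types (a b : R) (f : 'rV[R]_n -> R) (v : 'rV[R]_n).

Definition in_box a b v := forall i, a <= v ord0 i <= b.

Lemma box_min a b f : a <= b -> continuous f ->
  exists2 v, in_box a b v & forall w, in_box a b w -> f v <= f w.
Proof.
move=> ab cf.
pose K := [set v : 'rV[R]_n | forall i, `[a, b]%classic (v ord0 i)]%classic.
have Kbox v : (v \in K) <-> in_box a b v.
  split=> [/set_mem Kv i|bv]; first by have /= := Kv i; rewrite in_itv.
  by apply: mem_set => i /=; rewrite in_itv; apply: bv.
have [|||v vK vmin] := @EVT_min_rV R n f K.
- exists (const_mx a) => i /=; rewrite in_itv/= mxE lexx; exact: ab.
- exact: (@rV_compact R n (fun=> `[a, b]%classic) (fun=> @segment_compact _ a b)).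
- exact: continuous_subspaceT.
by exists v => [|w bw]; [exact/Kbox|apply: vmin; exact/Kbox].
Qed.

(** Passage to the limit by compactness: the minimum of [f] on the box is attained, and approximate
    zeros force it to vanish. *)
Lemma box_zero a b f (C : R) : a <= b -> continuous f -> (forall v, 0 <= f v) ->
    (forall e, 0 < e <= 1 -> exists2 v, in_box a b v & f v <= C * e) ->
  exists2 v, in_box a b v & f v = 0.
Proof.
move=> ab cf f0 fe; have [v bv vmin] := box_min ab cf.
exists v => //; apply/eqP; rewrite eq_le f0 andbT leNgt; apply/negP => fv0.
have s0 : 0 < f v + `|C| + 1 by rewrite -addrA addr_gt0// ltr_wpDl.
(* This [e] is at most 1, and [C * e < f v] because [C < f v + |C| + 1]. *)
have [|w bw fw] := fe (f v / (f v + `|C| + 1)).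
  rewrite divr_gt0// ler_pdivrMr// mul1r -addrA lerDl.
  by rewrite addr_ge0.
have := le_trans (vmin _ bw) fw; rewrite mulrA ler_pdivlMr// mulrC ler_pM2r//.
by have := ler_norm C; move: fv0; lra.
Qed.

(** The bound puts the sublevel set of [f 0] inside the box of half-width [|f 0 + c|], which
    contains 0. *)
Lemma proper_min f (c : R) : continuous f ->
    (forall v i, `|v ord0 i| <= f v + c) ->
  exists v, forall w, f v <= f w.
Proof.
move=> cf fc; pose B := `|f 0 + c|.
have B0 : - B <= B by rewrite ge0_cp//= /B.
have [v bv vmin] := box_min B0 cf.
exists v => w; have [fw|fw] := leP (f w) (f 0); last first.
  apply: le_trans (ltW fw); apply: vmin => i; rewrite mxE oppr_le0 /B.
  by rewrite normr_ge0.
apply: vmin => i; rewrite -ler_norml (le_trans (fc w i))//.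
by rewrite (le_trans _ (ler_norm _))// lerD2r.
Qed.

End Box.

(** * Derivatives in one real variable *)

Section Derivative.
Context {R : realType}.
Implicit Types (x c b : R).

Lemma is_derive_bigsum (I : Type) (r : seq I) (P : pred I) (f : I -> R -> R)
    (df : I -> R) x : (forall i, is_derive x 1 (f i) (df i)) ->
  is_derive x 1 (fun y => \sum_(i <- r | P i) f i y) (\sum_(i <- r | P i) df i).
Proof.
move=> fd; elim: r => [|i r IHr].
  under eq_fun do rewrite big_nil.
  by rewrite big_nil; apply: is_derive_cst.
under eq_fun do rewrite big_cons.
by rewrite big_cons; case: (P i) => //; apply: is_deriveD.
Qed.

Lemma is_derive_affine c b x : is_derive x 1 (fun y => c + y * b) b.
Proof.
have D := is_deriveD (is_derive_cst c x 1) (is_deriveM (is_derive_id x 1) (is_derive_cst b x 1)).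
by apply: (is_derive_eq D); rewrite /= scaler0 !add0r -[_ *: _]/(_ * _) mulr1.
Qed.

Lemma is_derive_expR_comp (f : R -> R) (df : R) x : is_derive x 1 f df ->
  is_derive x 1 (fun y => expR (f y)) (expR (f x) * df).
Proof. by move=> fd; apply: is_derive1_comp. Qed.

Lemma is_deriveMl c (f : R -> R) (df : R) x : is_derive x 1 f df ->
  is_derive x 1 (fun y => c * f y) (c * df).
Proof. by move=> fd; apply: (is_deriveZ c fd). Qed.

Lemma global_min_derive (f df : R -> R) x :
  (forall y : R, is_derive y 1 f (df y)) -> (forall y, f x <= f y) -> df x = 0.
Proof.
move=> fd fmin.
have xx : x \in `]x - 1, x + 1[ by rewrite in_itv/=; apply/andP; split; lra.
have := @derive1_at_min _ f (x - 1) (x + 1) x _ _ xx (fun t _ => fmin t).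
have le1 : x - 1 <= x + 1 by lra.
have dx (t : R) : t \in `]x - 1, x + 1[ -> derivable f t 1.
  by move=> _; apply: ex_derive.
move=> /(_ le1 dx) [_ <-]; have [_ ->] := fd x; done.
Qed.

End Derivative.

(** With [s = log u], this is coercivity of [e u^m - log u]. For [s >= 0], [expR (m s) >= expR (s /
    2) ^+ 2 >= s^2 / 4], and the constant [4 / e] completes the square [(e s - 4)^2 / (4 e)]. *)
Lemma expR_sub_coercive (R : realType) (m : nat) (e s : R) : (0 < m)%N -> 0 < e ->
  `|s| - 4 / e <= e * expR (m%:R * s) - s.
Proof.
move=> m0 e0; have e40 : 0 < 4 / e by rewrite divr_gt0.
have [s0|s0] := ger0P s; last first.
  by have := expR_gt0 (m%:R * s) => /(mulr_gt0 e0); lra.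
have ms : s ^+ 2 / 4 <= expR (m%:R * s).
  apply: (@le_trans _ _ (expR s)); last first.
    by rewrite ler_expR ler_peMl// ler1n.
  have -> : expR s = expR (s / 2) ^+ 2 by rewrite -expRM_natl; congr expR; field.
  apply: (@le_trans _ _ ((1 + s / 2) ^+ 2)); first by nra.
  by rewrite ler_pXn2r ?nnegrE ?expR_ge0 ?expR_ge1Dx//; lra.
have : e * (s ^+ 2 / 4) <= e * expR (m%:R * s) by rewrite ler_pM2l.
suff : 0 <= e * (s ^+ 2 / 4) - s * 2 + 4 / e by lra.
have -> : e * (s ^+ 2 / 4) - s * 2 + 4 / e = (e * s - 4) ^+ 2 / (4 * e).
  by field; lra.
by rewrite divr_ge0 ?sqr_ge0 ?mulr_ge0 ?ltW.
Qed.

(** * Multipliers and AM-GM weights from critical points *)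

Section Multipliers.
Context {R : realType} {L J : finType} {m n : nat}.
Variables (t : J -> 'I_m -> 'I_n) (d : L -> 'I_n -> R) (a : L -> J -> R).
Hypotheses (m_gt0 : (0 < m)%N) (a_ge0 : forall l j, 0 <= a l j).

Let dbar (lam : L -> R) i := \sum_l lam l * d l i.
Let abar (lam : L -> R) j := \sum_l lam l * a l j.

Hypothesis form_ge0 : forall u : 'I_n -> R, (forall i, 0 < u i) ->
  exists l, 0 <= \sum_i d l i * u i ^+ m - \sum_j a l j * \prod_k u (t j k).

(** In coordinates [v i = log (u i)] the open orthant becomes the whole space. The inequality for
    [i] is the vanishing of the [i]-th partial derivative at a minimiser, normalised, with a slack
    of [1 / m] dropped. *)
Lemma perturbed_multipliers (e : R) : 0 < e ->
  exists (lam : L -> R) (u : 'I_n -> R),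
    [/\ forall l, 0 <= lam l, \sum_l lam l = 1, forall i, 0 < u i &
        forall i, \sum_j \sum_(k | t j k == i)
          abar lam j / m%:R * \prod_k' u (t j k') <= (dbar lam i + e) * u i ^+ m].
Proof.
move=> e0.
(* The last sum, [- \sum_i v i], is the logarithm of the barrier [1 / \prod_i u_i]. *)
pose g l (v : 'I_n -> R) := \sum_i (d l i + e) * expR (m%:R * v i)
  - \sum_j a l j * expR (\sum_k v (t j k)) - \sum_i v i.
pose psi (v : 'rV[R]_n) := \sum_l expR (g l (v ord0)).
have cpsi : continuous psi.
  have cv i : continuous (fun v : 'rV[R]_n => v ord0 i) by apply: coord_continuous.
  apply: continuous_sum => l; apply: continuous_expRf.
  apply: continuous_subf; last exact: continuous_sum.
  apply: continuous_subf; apply: continuous_sum => i;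
    apply: continuous_scalef; apply: continuous_expRf.
    exact/continuous_scalef/cv.
  exact: continuous_sum.
(* At each point some form [l] is nonnegative, so the perturbation and the barrier alone bound [g l]
   below; moreover [psi >= expR (g l) >= 1 + g l]. *)
have psi_coercive (v : 'rV[R]_n) i : `|v ord0 i| <= psi v + n%:R * (4 / e).
  have [l fl] := form_ge0 (fun i => expR_gt0 (v ord0 i)).
  have gl : \sum_i (`|v ord0 i| - 4 / e) <= g l (v ord0).
    apply: (@le_trans _ _ (\sum_i (e * expR (m%:R * v ord0 i) - v ord0 i))).
      by apply: ler_sum => j _; apply: expR_sub_coercive.
    rewrite /g sumrB lerD2r -subr_ge0; apply: le_trans fl _.
    rewrite le_eqVlt; apply/orP; left; apply/eqP.
    under [in RHS]eq_bigr => j _ do rewrite mulrDl expRM_natl.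
    under [X in _ - X = _]eq_bigr => j _ do rewrite -expR_sum.
    under [X in _ = _ - X]eq_bigr => j _ do rewrite expRM_natl.
    by rewrite big_split/=; ring.
  have : psi v >= 1 + g l (v ord0).
    apply: le_trans (expR_ge1Dx _) _; rewrite /psi (bigD1 l)//= lerDl.
    by apply: sumr_ge0 => ? _; apply: expR_ge0.
  move: gl; rewrite sumrB sumr_const card_ord -[_ *+ n]mulr_natl (bigD1 i)//=.
  have : 0 <= \sum_(i0 < n | i0 != i) `|v ord0 i0| by apply: sumr_ge0.
  lra.
have [v vmin] := proper_min cpsi psi_coercive.
pose w l := expR (g l (v ord0)).
have stationary i : \sum_l w l * ((d l i + e) * (expR (m%:R * v ord0 i) * m%:R)
    - \sum_j a l j * (expR (\sum_k v ord0 (t j k)) * (\sum_(k | t j k == i) 1)) - 1) = 0.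
  (* The partial derivative is taken along the line through [v] in the direction [c] of the [i]-th
     basis vector. *)
  pose c (k : 'I_n) : R := (k == i)%:R.
  pose path (s : R) k := v ord0 k + s * c k.
  pose dg l s := \sum_k (d l k + e) * (expR (m%:R * path s k) * (m%:R * c k))
    - \sum_j a l j * (expR (\sum_k path s (t j k)) * (\sum_k c (t j k)))
    - \sum_k c k.
  have gd l (s : R) : is_derive s 1 (fun s => g l (path s)) (dg l s).
    have pd k : is_derive s 1 (fun s => path s k) (c k) by apply: is_derive_affine.
    apply: is_deriveB; last by apply: is_derive_bigsum.
    apply: is_deriveB; apply: is_derive_bigsum => k; apply: is_deriveMl.
    by apply: is_derive_expR_comp; apply: is_derive_bigsum.
  have path0 : path 0 = v ord0 by apply/funext => k; rewrite /path mul0r addr0.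
  transitivity (\sum_l expR (g l (path 0)) * dg l 0); last first.
    apply: (@global_min_derive R (fun s => \sum_l expR (g l (path s)))
      (fun s => \sum_l expR (g l (path s)) * dg l s)) => s.
      by apply: is_derive_bigsum => l; apply: is_derive_expR_comp (gd l s).
    rewrite path0; have := vmin (\row_k path s k); rewrite /psi.
    by rewrite (_ : (\row_k path s k) ord0 = path s)//; apply/funext => k; rewrite mxE.
  rewrite /dg path0.
  apply: eq_bigr => l _; congr (_ * (_ - _ - _)).
  - rewrite (bigD1 i)//= big1 ?addr0 /c ?eqxx ?mulr1// => k /negPf ->.
    by rewrite !mulr0.
  - apply: eq_bigr => j _; congr (_ * (_ * _)); rewrite big_mkcond.
    by apply: eq_bigr => k _; rewrite /c; case: eqP.
  - by rewrite (bigD1 i)//= big1 ?addr0 /c ?eqxx// => k /negPf ->.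
(* Only the existence of an index is used here: [L] is inhabited, hence [W > 0]. *)
have [l0 _] := form_ge0 (fun i => expR_gt0 (v ord0 i)).
pose W := \sum_l w l.
have W0 : 0 < W.
  rewrite /W (bigD1 l0)//= ltr_pwDl ?expR_gt0// sumr_ge0// => l _.
  exact: expR_ge0.
exists (fun l => w l / W), (fun i => expR (v ord0 i)); split.
- by move=> l; rewrite divr_ge0 ?expR_ge0// ltW.
- by rewrite -mulr_suml divff// gt_eqF.
- by move=> i; apply: expR_gt0.
move=> i; have m0 : 0 < m%:R :> R by rewrite ltr0n.
rewrite -expRM_natl -subr_ge0.
set E := expR (m%:R * v ord0 i).
pose N j : R := \sum_(k | t j k == i) 1.
pose Q j := expR (\sum_k v ord0 (t j k)).
pose A := \sum_l w l * d l i; pose B := \sum_j (\sum_l w l * a l j) * (Q j * N j).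
have dbarE : dbar (fun l => w l / W) i = A / W.
  by rewrite /A mulr_suml; apply: eq_bigr => l _; rewrite mulrAC.
have tailE : \sum_j \sum_(k | t j k == i) abar (fun l => w l / W) j / m%:R *
    \prod_k' expR (v ord0 (t j k')) = B / (W * m%:R).
  rewrite /B mulr_suml; apply: eq_bigr => j _; rewrite -expR_sum -/(Q j).
  have -> : abar (fun l => w l / W) j = (\sum_l w l * a l j) / W.
    by rewrite mulr_suml; apply: eq_bigr => l _; rewrite mulrAC.
  rewrite -[X in \sum_(_ | _) X]mulr1 -mulr_sumr -/(N j); field.
  by rewrite !gt_eqF.
have BE : B = (A + W * e) * (E * m%:R) - W.
  suff H : (A + W * e) * (E * m%:R) - B - W = 0.
    by rewrite -[RHS]subr0 -H; ring.
  have -> : B = \sum_l \sum_j w l * a l j * (Q j * N j).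
    by rewrite exchange_big; apply: eq_bigr => j _; rewrite mulr_suml.
  rewrite -[RHS](stationary i) /A /W mulr_suml -big_split mulr_suml -!sumrB.
  apply: eq_bigr => l _ /=; rewrite mulrBr mulrBr mulr1 mulr_sumr.
  congr (_ - _ - _); first by rewrite /E; ring.
  by apply: eq_bigr => j _; rewrite -mulrA.
rewrite dbarE tailE BE.
have -> : (A / W + e) * E - ((A + W * e) * (E * m%:R) - W) / (W * m%:R) = m%:R^-1.
  by field; rewrite !gt_eqF.
by rewrite invr_ge0 ltW.
Qed.

(** Let [e] tend to 0. The box ensures [0 <= lam l]; the other conditions become the vanishing of
    one continuous nonnegative function, with approximate zeros from the perturbed multipliers. *)
Lemma multipliers : exists (lam : L -> R) (r : J -> 'I_m -> R),
  [/\ forall l, 0 <= lam l, \sum_l lam l = 1,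
      forall j, \prod_k r j k = abar lam j / m%:R &
      forall i, \sum_j \sum_(k | t j k == i) r j k ^+ m <= dbar lam i].
Proof.
pose X : finType := (L + J * 'I_m)%type.
pose lam (v : 'rV[R]_#|X|) l := v ord0 (enum_rank (inl l : X)).
pose r (v : 'rV[R]_#|X|) j k := v ord0 (enum_rank (inr (j, k) : X)).
pose D := \sum_l \sum_i `|d l i|.
have D0 : 0 <= D by apply: sumr_ge0 => l _; apply: sumr_ge0.
pose excess v i := \sum_j \sum_(k | t j k == i) r v j k ^+ m - dbar (lam v) i.
(* [|x| + x] vanishes exactly when [x <= 0], which encodes the inequalities. *)
pose viol v := \sum_i (`|excess v i| + excess v i)
   + \sum_j `|\prod_k r v j k - abar (lam v) j / m%:R|
   + `|\sum_l lam v l - 1|.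
have pos (x : R) : 0 <= `|x| + x by have := ler_norm (- x); rewrite normrN; lra.
have viol1 v : 0 <= \sum_i (`|excess v i| + excess v i) by apply: sumr_ge0.
have viol2 v : 0 <= \sum_j `|\prod_k r v j k - abar (lam v) j / m%:R|.
  exact: sumr_ge0.
have viol0 v : 0 <= viol v by rewrite !addr_ge0.
have cviol : continuous viol.
  have cv i : continuous (fun v : 'rV[R]_#|X| => v ord0 i).
    by apply: coord_continuous.
  have cbar (b : L -> R) : continuous (fun v => \sum_l lam v l * b l).
    by apply: continuous_sum => l; exact: continuous_mulf (cv _) (@continuous_cstf _ _ _).
  have cexcess i : continuous (excess ^~ i).
    apply: continuous_subf; last exact: cbar.
    by do 2![apply: continuous_sum => ?]; apply/continuous_expf/cv.
  apply: continuous_addf; first apply: continuous_addf.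
  - apply: continuous_sum => i; apply: continuous_addf; last exact: cexcess.
    exact/continuous_normf/cexcess.
  - apply: continuous_sum => j; apply: continuous_normf.
    apply: continuous_subf; first by apply: continuous_prod => k; apply: cv.
    exact: continuous_mulf (cbar _) (@continuous_cstf _ _ _).
  - apply: continuous_normf; apply: continuous_subf; last exact: continuous_cstf.
    by apply: continuous_sum => l; apply: cv.
have D1 : 0 <= D + 1 by rewrite addr_ge0.
(* The factor [2 * n]: at the approximate solution only the [n] terms in [excess] can be nonzero,
   each at most [2 * e]. *)
have [e /andP[e0 e1]|v bv vz] := @box_zero R #|X| 0 (D + 1) viol (2 * n%:R) D1 cviol viol0.
  have [la [u [la0 la1 u0 hu]]] := perturbed_multipliers e0.
  (* Equality case of AM-GM: all [rr j k * u (t j k)] below equal [q j], the [m]-th root that makes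
     [\prod_k rr j k] equal to [abar la j / m]. *)
  pose q j := (abar la j / m%:R * \prod_k u (t j k)) `^ (m%:R^-1).
  have ab0 j : 0 <= abar la j / m%:R.
    by rewrite divr_ge0 ?ler0n// sumr_ge0// => l _; rewrite mulr_ge0.
  have pu0 j : 0 < \prod_k u (t j k) by apply: prodr_gt0 => k _.
  have qm j : q j ^+ m = abar la j / m%:R * \prod_k u (t j k).
    rewrite -powR_mulrn ?powR_ge0// -powRrM mulVf ?powRr1//.
      by rewrite mulr_ge0// ltW.
    by rewrite pnatr_eq0 -lt0n.
  pose rr j k := q j / u (t j k).
  pose v : 'rV[R]_#|X| := \row_x match enum_val x with
    | inl l => la l | inr jk => rr jk.1 jk.2 end.
  have lamv : lam v = la by apply/funext => l; rewrite /lam mxE enum_rankK.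
  have rv : r v = rr.
    by apply/funext => j; apply/funext => k; rewrite /r mxE enum_rankK.
  have rr0 j k : 0 <= rr j k by rewrite divr_ge0 ?powR_ge0// ltW.
  have rrm i : \sum_j \sum_(k | t j k == i) rr j k ^+ m <= dbar la i + e.
    rewrite -(ler_pM2r (exprn_gt0 m (u0 i))); apply: le_trans (hu i).
    rewrite mulr_suml; apply: ler_sum => j _; rewrite mulr_suml.
    apply: ler_sum => k /eqP jk; rewrite /rr jk exprMn qm exprVn divfK//.
    by rewrite gt_eqF// exprn_gt0.
  have dD i : dbar la i <= D.
    apply: ler_sum => l _; apply: le_trans (ler_norm _) _.
    rewrite normrM ger0_norm//; apply: (@le_trans _ _ `|d l i|).
      rewrite ler_piMl// -la1 (bigD1 l)//= lerDl; apply: sumr_ge0 => *; exact: la0.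
    by rewrite (bigD1 i)//= lerDl; apply: sumr_ge0.
  exists v.
    move=> x; rewrite -[x]enum_valK; case: (enum_val x) => [l|[j k]].
      rewrite -/(lam v l) lamv la0/= -[leLHS]addr0 addrC lerD//.
      by rewrite -la1 (bigD1 l)//= lerDl; apply: sumr_ge0 => *; exact: la0.
    (* If [rr j k > 1], it is at most its [m]-th power, one term of a nonnegative sum bounded by
       [dbar la (t j k) + e <= D + 1]. *)
    rewrite -/(r v j k) rv rr0/=; have [rle|rgt] := leP (rr j k) 1.
      by apply: le_trans rle _; rewrite lerDr.
    apply: (@le_trans _ _ (rr j k ^+ m)); first by rewrite ler_eXnr// ltW.
    apply: (@le_trans _ _ (dbar la (t j k) + e)); last exact: lerD.
    apply: le_trans (rrm _); rewrite (bigD1 j)//= (bigD1 k)//= -addrA lerDl.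
    rewrite addr_ge0//; repeat (apply: sumr_ge0 => ? _); exact: exprn_ge0.
  rewrite /viol lamv la1 subrr normr0 addr0 [X in _ + X]big1 ?addr0 => [|j _].
    apply: (@le_trans _ _ (\sum_(i < n) 2 * e)).
      apply: ler_sum => i _; have : excess v i <= e.
        by rewrite /excess rv lamv lerBlDl.
      by case: ger0P; lra.
    by rewrite sumr_const card_ord -[_ *+ n]mulr_natl mulrCA mulrA.
  rewrite rv /rr big_split/= prodr_const card_ord qm prodfV mulfK ?subrr ?normr0//.
  by rewrite gt_eqF.
exists (lam v), (r v); move/eqP: vz; rewrite /viol.
rewrite paddr_eq0 ?addr_ge0// paddr_eq0//.
rewrite !psumr_eq0// normr_eq0 subr_eq0 => /andP[/andP[/allP v1 /allP v2] /eqP v3].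
split=> //.
- by move=> l; have /andP[] := bv (enum_rank (inl l : X)).
- move=> j; have := v2 j (mem_index_enum _); rewrite normr_eq0 subr_eq0.
  by move/eqP.
- move=> i; have /eqP := v1 i (mem_index_enum _).
  rewrite -subr_le0 -/(excess v i); have := normr_ge0 (excess v i); lra.
Qed.

End Multipliers.
End CriticalPoint.

(** * Forms attached to tensors *)

Section TensorForms.
Context {R : realType} {m n : nat}.
Implicit Types (A : tensor R m n) (P : 'M[R]_n) (x y : 'rV[R]_n).

(** Extended by 0 to the diagonal, so that the tail can be summed over all index tuples. *)
Definition tail_coef A (j : {ffun 'I_m -> 'I_n}) : R :=
  if [exists i, j == [ffun=> i]] then 0 else - A j.

Lemma tail_coef_ge0 A j : essentially_nonpositive A -> 0 <= tail_coef A j.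
Proof.
move=> A_le0; rewrite /tail_coef; case: existsP => // jE.
by rewrite oppr_ge0; apply: A_le0 => -[i ji]; apply: jE; exists i; apply/eqP.
Qed.

Lemma tensor_inner_diag_tail A y : (0 < m)%N ->
  tensor_inner A (tensor_power y) =
  \sum_i A [ffun=> i] * y ord0 i ^+ m
    - \sum_j tail_coef A j * \prod_k y ord0 (j k).
Proof.
move=> m0; rewrite /tensor_inner.
rewrite (bigID (fun j : {ffun 'I_m -> 'I_n} => [exists i, j == [ffun=> i]]))/=.
congr (_ + _).
  (* Diagonal tuples correspond to indices; the inverse reads the first entry, which exists since
     [m > 0]. *)
  rewrite (reindex_onto (fun i : 'I_n => [ffun=> i] : {ffun 'I_m -> 'I_n})
    (fun j : {ffun 'I_m -> 'I_n} => j (Ordinal m0)))/=; last first.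
    by move=> j /existsP[i /eqP ->]; rewrite ffunE.
  rewrite (eq_bigl xpredT) => [|i]; last first.
    by rewrite ffunE eqxx andbT; apply/existsP; exists i.
  apply: eq_bigr => i _; rewrite ffunE; under eq_bigr => k _ do rewrite ffunE.
  by rewrite prodr_const card_ord.
rewrite -sumrN big_mkcond; apply: eq_bigr => j _; rewrite /tail_coef ffunE.
by case: existsP => _ /=; rewrite ?mul0r ?oppr0// mulNr opprK.
Qed.

(** Change of variables, by expanding the product of the entries of [y *m P] over all tuples. *)
Lemma tensor_inner_mulmx P A y :
  tensor_inner A (tensor_power (y *m P)) =
  tensor_inner (tensor_transform P A) (tensor_power y).
Proof.
rewrite /tensor_inner.
under [RHS]eq_bigr => i _ do rewrite !ffunE mulr_suml.
rewrite exchange_big; apply: eq_bigr => j _ /=; rewrite ffunE.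
rewrite (eq_bigr _ (fun k _ => mxE _ _ _ (j k))).
rewrite bigA_distr_bigA mulr_sumr; apply: eq_bigr => i _ /=.
by rewrite big_split/=; ring.
Qed.

Lemma tensor_inner_sum (I : finType) (lam : I -> R) (F : I -> tensor R m n) B :
  tensor_inner (\sum_l lam l *: F l) B = \sum_l lam l * tensor_inner (F l) B.
Proof.
rewrite /tensor_inner; under [RHS]eq_bigr => l _ do rewrite mulr_sumr.
rewrite exchange_big; apply: eq_bigr => j _; rewrite sum_ffunE mulr_suml.
by apply: eq_bigr => l _; rewrite ffunE mulrA.
Qed.

Lemma symmetric_tensor_sum (I : finType) (lam : I -> R) (F : I -> tensor R m n) :
  (forall l, symmetric_tensor (F l)) -> symmetric_tensor (\sum_l lam l *: F l).
Proof.
move=> symF s j; rewrite !sum_ffunE; apply: eq_bigr => l _.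
by rewrite !ffunE symF.
Qed.

End TensorForms.

(** * The theorem of the alternative *)

Theorem theorem3p1 (R : realType) (m n p : nat)
    (hm : (0 < m)%N) (hm_even : ~~ odd m) (hn : (0 < n)%N) (hp : (0 < p)%N)
    (F : 'I_p.+1 -> tensor R m n)
    (hF : forall l : 'I_p.+1, symmetric_tensor (F l))
    (hP : exists P : 'M[R]_n, P \in unitmx /\
       forall l : 'I_p.+1, essentially_nonpositive (tensor_transform P (F l))) :
  let stmt_i :=
    exists x : 'rV[R]_n, forall l : 'I_p.+1,
      tensor_inner (F l) (tensor_power x) < 0 in
  let stmt_ii :=
    exists lam : 'I_p.+1 -> R,
      [/\ forall l : 'I_p.+1, 0 <= lam l,
          \sum_(l < p.+1) lam l = 1
        & SOS_tensor (\sum_(l < p.+1) lam l *: F l)] in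
  (stmt_i \/ stmt_ii) /\ ~ (stmt_i /\ stmt_ii).
Proof.
move=> stmt_i stmt_ii; split; last first.
  (* Exclusion: at the [x] of (i) a sum of nonpositive terms is a sum of squares, so each term is 0;
     the forms being negative there, all [lam l] vanish, against their sum 1. *)
  move=> [[x Fx_lt0] [lam [lam_ge0 lam1 [_ [qs /(_ x)]]]]].
  rewrite tensor_inner_sum => sosE.
  have sos_ge0 : 0 <= \sum_l lam l * tensor_inner (F l) (tensor_power x).
    by rewrite sosE; apply: sumr_ge0 => q _; apply: sqr_ge0.
  have lamF_le0 l : lam l * tensor_inner (F l) (tensor_power x) <= 0.
    by rewrite mulr_ge0_le0// ltW.
  have : \sum_l lam l * - tensor_inner (F l) (tensor_power x) == 0.
    rewrite eq_le sumr_ge0 ?andbT => [|l _]; last by rewrite mulrN oppr_ge0.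
    by under eq_bigr => l _ do rewrite mulrN; rewrite sumrN oppr_le0.
  rewrite psumr_eq0 => [/allP lamF0|l _]; last by rewrite mulrN oppr_ge0.
  have lam0 l : lam l = 0.
    have := lamF0 l (mem_index_enum _).
    by rewrite mulf_eq0 oppr_eq0 (lt_eqF (Fx_lt0 l)) orbF => /eqP.
  by move: lam1; rewrite big1// => /esym/eqP; rewrite oner_eq0.
case: (boolp.EM stmt_i) => [|not_i]; [by left|right].
have [P [Punit G_le0]] := hP.
pose G l := tensor_transform P (F l).
have [u u_gt0|lam [r [lam_ge0 lam1 rprod rsum]]] := @CriticalPoint.multipliers R
  'I_p.+1 {ffun 'I_m -> 'I_n} m n (fun j k => j k) (fun l i => G l [ffun=> i])
  (fun l => tail_coef (G l)) hm (fun l j => tail_coef_ge0 j (G_le0 l)).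
  (* If all transformed forms were negative at the positive point [u], then [u P] would satisfy
     (i). *)
  apply: boolp.contrapT => neg; apply: not_i; exists ((\row_i u i) *m P) => l.
  rewrite tensor_inner_mulmx (tensor_inner_diag_tail _ _ hm) ltNge.
  apply/negP => Gu; apply: neg; exists l; move: Gu.
  under eq_bigr => i _ do rewrite mxE.
  by under [X in _ - X]eq_bigr => j _ do under eq_bigr => k _ do rewrite mxE.
exists lam; split=> //; split; first exact: symmetric_tensor_sum.
(* The [y i] are the coordinates of [x P^-1] as polynomials; substituting them into the transformed
   forms recovers the original ones. *)
pose y i : {mpoly R[n]} := \sum_j invmx P j i *: 'X_j.
have [qs qsE] := diagonal_minus_tail_is_sos y hm hm_even rprod rsum.
exists qs => x; have := congr1 (meval (x ord0)) qsE.
rewrite [X in _ = X]raddf_sum/=; under [X in _ = X]eq_bigr => q _ do rewrite rmorphXn.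
move=> <-; rewrite tensor_inner_sum.
have yx i : (y i).@[x ord0] = (x *m invmx P) ord0 i.
  rewrite raddf_sum mxE; apply: eq_bigr => j _ /=.
  by rewrite mevalZ mevalXU mulrC.
have Fx l : tensor_inner (F l) (tensor_power x) =
    tensor_inner (G l) (tensor_power (x *m invmx P)).
  by rewrite -tensor_inner_mulmx mulmxKV.
under [LHS]eq_bigr => l _ do
  rewrite Fx (tensor_inner_diag_tail _ _ hm) mulrBr !mulr_sumr.
rewrite sumrB mevalB; congr (_ - _); rewrite raddf_sum/=.
  rewrite exchange_big; apply: eq_bigr => i _; rewrite mevalZ rmorphXn/= yx mulr_suml.
  by apply: eq_bigr => l _; rewrite mulrA.
rewrite exchange_big; apply: eq_bigr => j _; rewrite mevalZ rmorph_prod mulr_suml.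
apply: eq_bigr => l _; rewrite mulrA; congr (_ * _).
by apply: eq_bigr => k _; apply: esym (yx _).
Qed.
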